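(* Let $(\mathcal{E},\otimes)$ be a locally subcartesian category. For every commuting square $p\circ f'=f\circ p'$, with $p'\colon P\to B$, $f'\colon P\to A$, $f\colon B\to X$, $p\colon A\to X$, which factors through the chosen subpullback of $p$ and $f$, there is a canonical natural transformation $$\mathfrak{b}\colon\Sigma_{f'}\nabla_{p'}\Rightarrow\nabla_p\Sigma_f\colon\mathcal{E}/B\to\mathcal{E}/A,$$ and these transformations are coherent with respect to nullary and binary pastings of squares. The transformation $\mathfrak{b}$ is invertible if and only if the original square is a subpullback.
   Context: A commuting square $fg'=gf'$ on a cospan $f\colon A\to X$, $g\colon B\to X$ is subcartesian if the pair $(g',f')$ is jointly monic. A locally subcartesian category $(\mathcal{E},\otimes)$ is a category $\mathcal{E}$ with, for each cospan $f\colon A\to X$, $g\colon B\to X$, a chosen subcartesian square (the chosen subpullback) with apex $A\otimes_X B$ and projections $g'\colon A\otimes_X B\to A$, $f'\colon A\otimes_X B\to B$, subject to: (symmetry) there are isomorphisms $A\otimes_X B\cong B\otimes_X A$ commuting with the projections; (nullary) if $g$ is an identity then so is $g'$; (binary) for $p\colon W\to Y$, $q\colon Y\to Z$, $g\colon B\to Z$, with $g'\colon Y\otimes_Z B\to Y$, pasting the chosen square of $(p,g')$ with the chosen square of $(q,g)$ gives a square isomorphic, compatibly with the projections to $W$ and $B$, to the chosen square of $(qp,g)$. A commuting square is called a subpullback if it is isomorphic, compatibly with projections, to the chosen square of its cospan. A commuting square with apex $P$ factors through the chosen subpullback if there is a (necessarily unique) morphism from $P$ to the apex of the chosen square commuting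 with the projections. For $f\colon X\to Y$, $\Sigma_f\colon\mathcal{E}/X\to\mathcal{E}/Y$ is composition with $f$, and $\nabla_f\colon\mathcal{E}/Y\to\mathcal{E}/X$ sends $h\colon H\to Y$ to the projection $X\otimes_Y H\to X$ and sends $u\colon h\to h_1$ to the unique morphism $X\otimes_Y H\to X\otimes_Y H_1$ over $X$ compatible with $u$ and the projections to $H,H_1$. These form a pseudofunctor $\nabla_{(-)}\colon\mathcal{E}^{\mathrm{op}}\to\mathbf{Cat}$. ''Canonical'' means that the component of $\mathfrak{b}$ at $h\colon M\to B$ is the (unique) morphism $P\otimes_B M\to A\otimes_X M$ commuting with the maps to $A$ and to $M$. Coherence means that identity squares give identity transformations and that horizontal and vertical pastings of such squares are sent to the corresponding pastings of transformations, up to the pseudofunctoriality isomorphisms of $\nabla$ and $\Sigma$. *)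

(* Defs.v *)
From Stdlib Require Import ClassicalEpsilon FunctionalExtensionality.

Set Implicit Arguments.
Unset Strict Implicit.
Unset Printing Implicit Defensive.

Declare Scope cat_scope.
Open Scope cat_scope.

Record Category := {
  ob :> Type;
  hom : ob -> ob -> Type;
  idm : forall A : ob, hom A A;
  comp : forall A B C : ob, hom B C -> hom A B -> hom A C;
  comp_id_l : forall A B (f : hom A B), comp (idm B) f = f;
  comp_id_r : forall A B (f : hom A B), comp f (idm A) = f;
  comp_assoc : forall A B C D (h : hom C D) (g : hom B C) (f : hom A B),
    comp h (comp g f) = comp (comp h g) f }.

Arguments idm {c} A.
Arguments comp {c A B C} g f : rename.

Notation "g ∘ f" := (comp g f) (at level 40, left associativity) : cat_scope.

Definition is_iso {C : Category} {A B : C} (f : hom A B) : Prop :=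
  exists g : hom B A, g ∘ f = idm A /\ f ∘ g = idm B.

(* [is_identity f] says that domain and codomain of [f] are equal objects and
   that, along this equality, [f] is an identity morphism. *)
Inductive is_identity {C : Category} : forall A B : C, hom A B -> Prop :=
| is_identity_idm : forall A : C, is_identity (idm A).

Record Functor (C D : Category) := {
  fob :> C -> D;
  fmap : forall A B : C, hom A B -> hom (fob A) (fob B);
  fmap_id : forall A : C, fmap (idm A) = idm (fob A);
  fmap_comp : forall (A B B' : C) (g : hom B B') (f : hom A B),
    fmap (g ∘ f) = fmap g ∘ fmap f }.

Arguments fmap {C D} f {A B} _ : rename.

Definition functor_id (C : Category) : Functor C C :=
  {| fob := fun A => A;
     fmap := fun A B f => f;
     fmap_id := fun A => eq_refl;
     fmap_comp := fun A B B' g f => eq_refl |}.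

Definition functor_comp {C D K : Category} (G : Functor D K) (F : Functor C D) :
  Functor C K.
Proof.
  refine {| fob := fun A => G (F A);
            fmap := fun A B f => fmap G (fmap F f) |}.
  - intros A. now rewrite !fmap_id.
  - intros A B B' g f. now rewrite !fmap_comp.
Defined.

Notation "G ○ F" := (functor_comp G F) (at level 40, left associativity)
  : cat_scope.

Record NatTrans {C D : Category} (F G : Functor C D) := {
  component :> forall A : C, hom (F A) (G A);
  naturality : forall (A B : C) (f : hom A B),
    component B ∘ fmap F f = fmap G f ∘ component A }.

Lemma nat_ext {C D : Category} (F G : Functor C D) (a b : NatTrans F G) :
  (forall A, a A = b A) -> a = b.
Proof.
  destruct a as [a Ha], b as [b Hb]; simpl; intros H.
  assert (a = b) by (apply functional_extensionality_dep; exact H); subst b.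
  f_equal; apply proof_irrelevance.
Qed.

Definition nat_id {C D : Category} (F : Functor C D) : NatTrans F F.
Proof.
  refine {| component := fun A => idm (F A) |}.
  intros A B f. now rewrite comp_id_l, comp_id_r.
Defined.

Definition nat_comp {C D : Category} {F G H : Functor C D}
  (b : NatTrans G H) (a : NatTrans F G) : NatTrans F H.
Proof.
  refine {| component := fun A => b A ∘ a A |}.
  intros A B f.
  now rewrite <- comp_assoc, naturality, comp_assoc, naturality, <- comp_assoc.
Defined.

Notation "b • a" := (nat_comp b a) (at level 50, left associativity)
  : cat_scope.

Definition invertible {C D : Category} {F G : Functor C D} (a : NatTrans F G) :
  Prop :=
  exists b : NatTrans G F, b • a = nat_id F /\ a • b = nat_id G.

Record NatIso {C D : Category} (F G : Functor C D) := {
  iso_nat :> NatTrans F G;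
  iso_invertible : invertible iso_nat }.

Definition whisker_l {C D K : Category} (H : Functor D K) {F G : Functor C D}
  (a : NatTrans F G) : NatTrans (H ○ F) (H ○ G).
Proof.
  refine {| component := fun A => fmap H (a A) : hom ((H ○ F) A) ((H ○ G) A) |}.
  intros A B f; simpl. now rewrite <- !fmap_comp, naturality.
Defined.

Definition whisker_r {B C D : Category} {F G : Functor C D}
  (a : NatTrans F G) (H : Functor B C) : NatTrans (F ○ H) (G ○ H).
Proof.
  refine {| component := fun A => a (H A) : hom ((F ○ H) A) ((G ○ H) A) |}.
  intros A A' f; simpl. apply naturality.
Defined.

(* A transformation [F' ○ P' => P ○ F] is regarded as a 2-cell in the square
   with horizontal sides [F'] (top), [F] (bottom) and vertical sides [P] (right),
   [P'] (left), the vertical functors pointing upwards. [hid], [vid] are the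
   identity 2-cells, and [hpaste], [vpaste] the pastings, in such squares. *)

Definition hid {C D : Category} (P : Functor C D) :
  NatTrans (functor_id D ○ P) (P ○ functor_id C).
Proof.
  refine {| component := fun A =>
    idm (P A) : hom ((functor_id D ○ P) A) ((P ○ functor_id C) A) |}.
  intros A B f; simpl. now rewrite comp_id_l, comp_id_r.
Defined.

Definition vid {C D : Category} (F : Functor C D) :
  NatTrans (F ○ functor_id C) (functor_id D ○ F).
Proof.
  refine {| component := fun A =>
    idm (F A) : hom ((F ○ functor_id C) A) ((functor_id D ○ F) A) |}.
  intros A B f; simpl. now rewrite comp_id_l, comp_id_r.
Defined.

Definition hpaste {CP CA CC CB CX CZ : Category}
  {F' : Functor CP CA} {G' : Functor CA CC} {F : Functor CB CX}
  {G : Functor CX CZ} {P' : Functor CB CP} {P : Functor CX CA}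
  {Q : Functor CZ CC}
  (a : NatTrans (F' ○ P') (P ○ F)) (b : NatTrans (G' ○ P) (Q ○ G)) :
  NatTrans ((G' ○ F') ○ P') (Q ○ (G ○ F)).
Proof.
  refine {| component := fun M =>
    (b (F M) : hom (G' (P (F M))) (Q (G (F M)))) ∘ fmap G' (a M)
    : hom (((G' ○ F') ○ P') M) ((Q ○ (G ○ F)) M) |}.
  intros M N u; simpl.
  rewrite <- comp_assoc, <- fmap_comp.
  pose proof (naturality a u) as Ha; simpl in Ha; rewrite Ha.
  pose proof (naturality b (fmap F u)) as Hb; simpl in Hb.
  now rewrite fmap_comp, !comp_assoc, Hb.
Defined.

Definition vpaste {CQ CC CP CA CB CX : Category}
  {F'' : Functor CQ CC} {F' : Functor CP CA} {F : Functor CB CX}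
  {Q' : Functor CP CQ} {Q : Functor CA CC}
  {P' : Functor CB CP} {P : Functor CX CA}
  (a : NatTrans (F' ○ P') (P ○ F)) (b : NatTrans (F'' ○ Q') (Q ○ F')) :
  NatTrans (F'' ○ (Q' ○ P')) ((Q ○ P) ○ F).
Proof.
  refine {| component := fun M =>
    fmap Q (a M) ∘ (b (P' M) : hom (F'' (Q' (P' M))) (Q (F' (P' M))))
    : hom ((F'' ○ (Q' ○ P')) M) (((Q ○ P) ○ F) M) |}.
  intros M N u; simpl.
  pose proof (naturality b (fmap P' u)) as Hb; simpl in Hb.
  pose proof (naturality a u) as Ha; simpl in Ha.
  now rewrite <- comp_assoc, Hb, !comp_assoc, <- !fmap_comp, Ha.
Defined.

Record SliceOb {E : Category} (X : E) := { dom : E; arr : hom dom X }.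

Record SliceHom {E : Category} {X : E} (h k : SliceOb X) := {
  mor : hom (dom h) (dom k);
  mor_over : arr k ∘ mor = arr h }.

Lemma slice_ext {E : Category} {X : E} {h k : SliceOb X} (u v : SliceHom h k) :
  mor u = mor v -> u = v.
Proof.
  destruct u as [u Hu], v as [v Hv]; simpl; intros ->.
  f_equal; apply proof_irrelevance.
Qed.

Definition slice_id {E : Category} {X : E} (h : SliceOb X) : SliceHom h h :=
  {| mor := idm (dom h); mor_over := comp_id_r (arr h) |}.

Lemma slice_comp_over {E : Category} {X : E} {h k l : SliceOb X}
  (v : SliceHom k l) (u : SliceHom h k) : arr l ∘ (mor v ∘ mor u) = arr h.
Proof. now rewrite comp_assoc, !mor_over. Qed.

Definition slice_comp {E : Category} {X : E} {h k l : SliceOb X}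
  (v : SliceHom k l) (u : SliceHom h k) : SliceHom h l :=
  {| mor := mor v ∘ mor u; mor_over := slice_comp_over v u |}.

Definition Slice {E : Category} (X : E) : Category.
Proof.
  refine {| ob := SliceOb X;
            hom := fun h k => SliceHom h k;
            idm := slice_id;
            comp := fun h k l v u => slice_comp v u |}.
  - intros h k u; apply slice_ext, comp_id_l.
  - intros h k u; apply slice_ext, comp_id_r.
  - intros h k l m w v u; apply slice_ext, comp_assoc.
Defined.

(* Below, a square consists of a span [a : P -> A],
   [b : P -> B] and a cospan [f : A -> X], [g : B -> X]. *)

Definition commutes {E : Category} {P A B X : E} (a : hom P A) (b : hom P B)
  (f : hom A X) (g : hom B X) : Prop := f ∘ a = g ∘ b.

Definition jointly_monic {E : Category} {P A B : E} (a : hom P A) (b : hom P B) :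
  Prop :=
  forall (Z : E) (u v : hom Z P), a ∘ u = a ∘ v -> b ∘ u = b ∘ v -> u = v.

Definition subcartesian {E : Category} {P A B X : E} (a : hom P A) (b : hom P B)
  (f : hom A X) (g : hom B X) : Prop :=
  commutes a b f g /\ jointly_monic a b.

(* The comparison need not be unique in general; it is when the target span is
   jointly monic, as for a chosen square. *)
Definition span_map {E : Category} {P P' A B : E} (a : hom P A) (b : hom P B)
  (a' : hom P' A) (b' : hom P' B) : Prop :=
  exists k : hom P P', a' ∘ k = a /\ b' ∘ k = b.

Definition span_iso {E : Category} {P P' A B : E} (a : hom P A) (b : hom P B)
  (a' : hom P' A) (b' : hom P' B) : Prop :=
  exists k : hom P P', is_iso k /\ a' ∘ k = a /\ b' ∘ k = b.

(* For [f : A -> X] and [g : B -> X], [tens f g] is the apex of the chosen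
   square, with projections [pr1 f g] to [A] and [pr2 f g] to [B]. *)
Record LocallySubcartesian (E : Category) := {
  tens : forall A B X : E, hom A X -> hom B X -> E;
  pr1 : forall (A B X : E) (f : hom A X) (g : hom B X), hom (tens f g) A;
  pr2 : forall (A B X : E) (f : hom A X) (g : hom B X), hom (tens f g) B;
  chosen_subcartesian : forall (A B X : E) (f : hom A X) (g : hom B X),
    subcartesian (pr1 f g) (pr2 f g) f g;
  chosen_symmetry : forall (A B X : E) (f : hom A X) (g : hom B X),
    span_iso (pr1 f g) (pr2 f g) (pr2 g f) (pr1 g f);
  chosen_nullary : forall (A B X : E) (f : hom A X) (g : hom B X),
    is_identity g -> is_identity (pr1 f g);
  chosen_binary : forall (W Y Z B : E)
      (p : hom W Y) (q : hom Y Z) (g : hom B Z),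
    span_iso (pr1 p (pr1 q g)) (pr2 q g ∘ pr2 p (pr1 q g))
             (pr1 (q ∘ p) g) (pr2 (q ∘ p) g) }.

Arguments tens {E} S {A B X} f g : rename.
Arguments pr1 {E} S {A B X} f g : rename.
Arguments pr2 {E} S {A B X} f g : rename.
Arguments chosen_subcartesian {E} S {A B X} f g : rename.
Arguments chosen_symmetry {E} S {A B X} f g : rename.
Arguments chosen_nullary {E} S {A B X} f {g} _ : rename.
Arguments chosen_binary {E} S {W Y Z B} p q g : rename.

Definition is_subpullback {E : Category} (S : LocallySubcartesian E)
  {P A B X : E} (a : hom P A) (b : hom P B) (f : hom A X) (g : hom B X) : Prop :=
  commutes a b f g /\ span_iso a b (pr1 S f g) (pr2 S f g).

Record factoring_square {E : Category} (S : LocallySubcartesian E)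
  {P A B X : E} (a : hom P A) (b : hom P B) (f : hom A X) (g : hom B X) : Prop := {
  square_commutes : commutes a b f g;
  square_factors : span_map a b (pr1 S f g) (pr2 S f g) }.

Lemma chosen_commutes {E : Category} (S : LocallySubcartesian E) {A B X : E}
  (f : hom A X) (g : hom B X) : f ∘ pr1 S f g = g ∘ pr2 S f g.
Proof. exact (proj1 (chosen_subcartesian S f g)). Qed.

Lemma chosen_ext {E : Category} (S : LocallySubcartesian E) {A B X Z : E}
  (f : hom A X) (g : hom B X) (u v : hom Z (tens S f g)) :
  pr1 S f g ∘ u = pr1 S f g ∘ v -> pr2 S f g ∘ u = pr2 S f g ∘ v -> u = v.
Proof. exact (proj2 (chosen_subcartesian S f g) Z u v). Qed.

Lemma span_iso_map {E : Category} {P P' A B : E} {a : hom P A} {b : hom P B}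
  {a' : hom P' A} {b' : hom P' B} :
  span_iso a b a' b' -> span_map a b a' b'.
Proof. intros [k [_ H]]; now exists k. Qed.

Lemma span_iso_map_inv {E : Category} {P P' A B : E} {a : hom P A} {b : hom P B}
  {a' : hom P' A} {b' : hom P' B} :
  span_iso a b a' b' -> span_map a' b' a b.
Proof.
  intros [k [[l [_ H]] [<- <-]]]; exists l.
  now rewrite <- !comp_assoc, H, !comp_id_r.
Qed.

Lemma span_map_trans {E : Category} {P P' P'' A B : E}
  {a : hom P A} {b : hom P B} {a' : hom P' A} {b' : hom P' B}
  {a'' : hom P'' A} {b'' : hom P'' B} :
  span_map a b a' b' -> span_map a' b' a'' b'' -> span_map a b a'' b''.
Proof.
  intros [k [<- <-]] [l [<- <-]]; exists (l ∘ k); now rewrite !comp_assoc.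
Qed.

Lemma span_map_swap {E : Category} {P P' A B : E} {a : hom P A} {b : hom P B}
  {a' : hom P' A} {b' : hom P' B} :
  span_map a b a' b' -> span_map b a b' a'.
Proof. intros [k [H1 H2]]; now exists k. Qed.

Lemma is_identity_iso {C : Category} {A B : C} (f : hom A B) :
  is_identity f -> is_iso f.
Proof. intros []; exists (idm A0); now rewrite comp_id_l. Qed.

Definition sigma_ob {E : Category} {X Y : E} (f : hom X Y) (h : SliceOb X) :
  SliceOb Y := {| dom := dom h; arr := f ∘ arr h |}.

Definition sigma_hom {E : Category} {X Y : E} (f : hom X Y) {h k : SliceOb X}
  (u : SliceHom h k) : SliceHom (sigma_ob f h) (sigma_ob f k).
Proof.
  refine {| mor := mor u : hom (dom (sigma_ob f h)) (dom (sigma_ob f k)) |}.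
  simpl; now rewrite <- comp_assoc, mor_over.
Defined.

Definition Sigma {E : Category} {X Y : E} (f : hom X Y) :
  Functor (Slice X) (Slice Y).
Proof.
  refine {| fob := sigma_ob f : Slice X -> Slice Y;
            fmap := fun h k u => sigma_hom f u |}.
  - intros h; now apply slice_ext.
  - intros h k l v u; now apply slice_ext.
Defined.

Lemma nabla_map_exists {E : Category} (S : LocallySubcartesian E)
  {X Y H H1 : E} (f : hom X Y) {h : hom H Y} {h1 : hom H1 Y} (u : hom H H1)
  (Hu : h1 ∘ u = h) :
  exists! m : hom (tens S f h) (tens S f h1),
    pr1 S f h1 ∘ m = pr1 S f h /\ pr2 S f h1 ∘ m = u ∘ pr2 S f h.
Proof.
  subst h.
  assert (Hm : span_map (pr1 S f (h1 ∘ u)) (u ∘ pr2 S f (h1 ∘ u))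
                        (pr1 S f h1) (pr2 S f h1)).
  { destruct (span_iso_map (chosen_symmetry S f (h1 ∘ u))) as [s [Hs1 Hs2]].
    destruct (span_iso_map_inv (chosen_binary S u h1 f)) as [k [Hk1 Hk2]].
    destruct (span_iso_map (chosen_symmetry S h1 f)) as [t [Ht1 Ht2]].
    exists (t ∘ pr2 S u (pr1 S h1 f) ∘ k ∘ s); split.
    - now rewrite !comp_assoc, Ht2, Hk2, Hs1.
    - rewrite !comp_assoc, Ht1, <- chosen_commutes, <- (comp_assoc u), Hk1.
      now rewrite <- comp_assoc, Hs2. }
  destruct Hm as [m [Hm1 Hm2]]; exists m; split; [now split|].
  intros m' [Hm1' Hm2']; apply chosen_ext; congruence.
Qed.

Definition nabla_map {E : Category} (S : LocallySubcartesian E)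
  {X Y H H1 : E} (f : hom X Y) {h : hom H Y} {h1 : hom H1 Y} (u : hom H H1)
  (Hu : h1 ∘ u = h) : hom (tens S f h) (tens S f h1) :=
  proj1_sig (constructive_indefinite_description _ (nabla_map_exists S f Hu)).

Lemma nabla_map_spec {E : Category} (S : LocallySubcartesian E)
  {X Y H H1 : E} (f : hom X Y) {h : hom H Y} {h1 : hom H1 Y} (u : hom H H1)
  (Hu : h1 ∘ u = h) :
  pr1 S f h1 ∘ nabla_map S f Hu = pr1 S f h /\
  pr2 S f h1 ∘ nabla_map S f Hu = u ∘ pr2 S f h.
Proof.
  exact (proj1 (proj2_sig
    (constructive_indefinite_description _ (nabla_map_exists S f Hu)))).
Qed.

Lemma nabla_map_id {E : Category} (S : LocallySubcartesian E)
  {X Y H : E} (f : hom X Y) {h : hom H Y} (Hh : h ∘ idm H = h) :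
  nabla_map S f Hh = idm (tens S f h).
Proof.
  destruct (nabla_map_spec S f Hh) as [H1 H2].
  apply chosen_ext; rewrite comp_id_r; [exact H1|].
  now rewrite H2, comp_id_l.
Qed.

Lemma nabla_map_comp {E : Category} (S : LocallySubcartesian E)
  {X Y H H1 H2 : E} (f : hom X Y) {h : hom H Y} {h1 : hom H1 Y} {h2 : hom H2 Y}
  (u : hom H H1) (v : hom H1 H2) (Hu : h1 ∘ u = h) (Hv : h2 ∘ v = h1)
  (Hvu : h2 ∘ (v ∘ u) = h) :
  nabla_map S f Hvu = nabla_map S f Hv ∘ nabla_map S f Hu.
Proof.
  destruct (nabla_map_spec S f Hu) as [A1 A2].
  destruct (nabla_map_spec S f Hv) as [B1 B2].
  destruct (nabla_map_spec S f Hvu) as [C1 C2].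
  apply chosen_ext; rewrite comp_assoc.
  - now rewrite B1, A1.
  - now rewrite B2, <- comp_assoc, A2, C2, comp_assoc.
Qed.

Definition nabla_ob {E : Category} (S : LocallySubcartesian E) {X Y : E}
  (f : hom X Y) (h : SliceOb Y) : SliceOb X :=
  {| dom := tens S f (arr h); arr := pr1 S f (arr h) |}.

Definition nabla_hom {E : Category} (S : LocallySubcartesian E) {X Y : E}
  (f : hom X Y) {h k : SliceOb Y} (u : SliceHom h k) :
  SliceHom (nabla_ob S f h) (nabla_ob S f k) :=
  {| mor := nabla_map S f (mor_over u)
       : hom (dom (nabla_ob S f h)) (dom (nabla_ob S f k));
     mor_over := proj1 (nabla_map_spec S f (mor_over u)) |}.

Definition Nabla {E : Category} (S : LocallySubcartesian E) {X Y : E}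
  (f : hom X Y) : Functor (Slice Y) (Slice X).
Proof.
  refine {| fob := nabla_ob S f : Slice Y -> Slice X;
            fmap := fun h k u => nabla_hom S f u |}.
  - intros h; apply slice_ext, nabla_map_id.
  - intros h k l v u; apply slice_ext, nabla_map_comp.
Defined.

Lemma invertible_of_components {C D : Category} {F G : Functor C D}
  (a : NatTrans F G) : (forall A, is_iso (a A)) -> invertible a.
Proof.
  intros H.
  set (c := fun A => proj1_sig (constructive_indefinite_description _ (H A))).
  assert (Hc : forall A, c A ∘ a A = idm _ /\ a A ∘ c A = idm _)
    by (intros A; exact (proj2_sig (constructive_indefinite_description _ (H A)))).
  assert (Hn : forall A B (f : hom A B), c B ∘ fmap G f = fmap F f ∘ c A).
  { intros A B f.
    rewrite <- (comp_id_r (fmap G f)), <- (proj2 (Hc A)).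
    rewrite (comp_assoc (fmap G f)), <- naturality, !comp_assoc.
    now rewrite (proj1 (Hc B)), comp_id_l. }
  exists {| component := c; naturality := Hn |}.
  split; apply nat_ext; intros A; apply (Hc A).
Qed.

Lemma slice_iso {E : Category} {X : E} {h k : Slice X} (u : hom h k) :
  is_iso (mor u) -> is_iso u.
Proof.
  intros [v [H1 H2]].
  assert (Hv : arr h ∘ v = arr k)
    by now rewrite <- (mor_over u), <- comp_assoc, H2, comp_id_r.
  exists {| mor := v; mor_over := Hv |}.
  split; now apply slice_ext.
Qed.

(* The components of [sigma_id] and [sigma_comp] are identities in [E]. *)
Definition sigma_id {E : Category} (X : E) :
  NatIso (Sigma (idm X)) (functor_id (Slice X)).
Proof.
  unshelve refine {| iso_nat := @Build_NatTrans _ _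
    (Sigma (idm X)) (functor_id (Slice X))
    (fun h => @Build_SliceHom E X (Sigma (idm X) h) (functor_id (Slice X) h)
       (idm (dom h)) _) _ |}.
  - simpl; now rewrite comp_id_l, comp_id_r.
  - intros h k u; apply slice_ext; simpl. now rewrite comp_id_l, comp_id_r.
  - apply invertible_of_components; intros h; apply slice_iso; simpl.
    exists (idm (dom h)); now rewrite comp_id_l.
Defined.

Definition sigma_comp {E : Category} {X Y Z : E} (g : hom Y Z) (f : hom X Y) :
  NatIso (Sigma (g ∘ f)) (Sigma g ○ Sigma f).
Proof.
  unshelve refine {| iso_nat := @Build_NatTrans _ _
    (Sigma (g ∘ f)) (Sigma g ○ Sigma f)
    (fun h => @Build_SliceHom E Z (Sigma (g ∘ f) h) ((Sigma g ○ Sigma f) h)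
       (idm (dom h)) _) _ |}.
  - simpl; now rewrite comp_id_r, comp_assoc.
  - intros h k u; apply slice_ext; simpl. now rewrite comp_id_l, comp_id_r.
  - apply invertible_of_components; intros h; apply slice_iso; simpl.
    exists (idm (dom h)); now rewrite comp_id_l.
Defined.

Lemma pr2_id_iso {E : Category} (S : LocallySubcartesian E) {X H : E}
  (h : hom H X) : is_iso (pr2 S (idm X) h).
Proof.
  destruct (is_identity_iso (chosen_nullary S h (is_identity_idm X)))
    as [v [Hv1 Hv2]].
  destruct (chosen_symmetry S (idm X) h) as [s [[t [Hs1 Hs2]] [_ <-]]].
  exists (t ∘ v); split.
  - now rewrite <- comp_assoc, (comp_assoc v), Hv1, comp_id_l.
  - now rewrite <- comp_assoc, (comp_assoc s), Hs2, comp_id_l.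
Qed.

(* The component at [h] is the projection to the domain of [h]. *)
Definition nabla_id {E : Category} (S : LocallySubcartesian E) (X : E) :
  NatIso (Nabla S (idm X)) (functor_id (Slice X)).
Proof.
  unshelve refine {| iso_nat := @Build_NatTrans _ _
    (Nabla S (idm X)) (functor_id (Slice X))
    (fun h => @Build_SliceHom E X (Nabla S (idm X) h) (functor_id (Slice X) h)
       (pr2 S (idm X) (arr h)) _) _ |}.
  - simpl; now rewrite <- chosen_commutes, comp_id_l.
  - intros h k u; apply slice_ext; simpl. apply nabla_map_spec.
  - apply invertible_of_components; intros h; apply slice_iso; simpl.
    apply pr2_id_iso.
Defined.

Lemma nabla_comp_exists {E : Category} (S : LocallySubcartesian E)
  {W Y Z H : E} (q : hom Y Z) (p : hom W Y) (h : hom H Z) :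
  exists! m : hom (tens S (q ∘ p) h) (tens S p (pr1 S q h)),
    pr1 S p (pr1 S q h) ∘ m = pr1 S (q ∘ p) h /\
    pr2 S q h ∘ pr2 S p (pr1 S q h) ∘ m = pr2 S (q ∘ p) h.
Proof.
  destruct (span_iso_map_inv (chosen_binary S p q h)) as [m [H1 H2]].
  exists m; split; [now split|].
  intros m' [H1' H2']; apply chosen_ext; [congruence|].
  apply chosen_ext; rewrite !comp_assoc; [|congruence].
  rewrite <- !chosen_commutes, <- !comp_assoc. congruence.
Qed.

Definition nabla_comp_map {E : Category} (S : LocallySubcartesian E)
  {W Y Z H : E} (q : hom Y Z) (p : hom W Y) (h : hom H Z) :
  hom (tens S (q ∘ p) h) (tens S p (pr1 S q h)) :=
  proj1_sig (constructive_indefinite_description _ (nabla_comp_exists S q p h)).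

Lemma nabla_comp_map_spec {E : Category} (S : LocallySubcartesian E)
  {W Y Z H : E} (q : hom Y Z) (p : hom W Y) (h : hom H Z) :
  pr1 S p (pr1 S q h) ∘ nabla_comp_map S q p h = pr1 S (q ∘ p) h /\
  pr2 S q h ∘ pr2 S p (pr1 S q h) ∘ nabla_comp_map S q p h = pr2 S (q ∘ p) h.
Proof.
  exact (proj1 (proj2_sig
    (constructive_indefinite_description _ (nabla_comp_exists S q p h)))).
Qed.

Lemma nabla_comp_map_natural {E : Category} (S : LocallySubcartesian E)
  {W Y Z H K : E} (q : hom Y Z) (p : hom W Y) {h : hom H Z} {k : hom K Z}
  (u : hom H K) (Hu : k ∘ u = h)
  (Hu' : pr1 S q k ∘ nabla_map S q Hu = pr1 S q h) :
  nabla_comp_map S q p k ∘ nabla_map S (q ∘ p) Hu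
  = nabla_map S p Hu' ∘ nabla_comp_map S q p h.
Proof.
  destruct (nabla_comp_map_spec S q p h) as [A1 A2].
  destruct (nabla_comp_map_spec S q p k) as [B1 B2].
  destruct (nabla_map_spec S (q ∘ p) Hu) as [C1 C2].
  destruct (nabla_map_spec S p Hu') as [D1 D2].
  destruct (nabla_map_spec S q Hu) as [F1 F2].
  assert (G : pr1 S p (pr1 S q k)
                ∘ (nabla_comp_map S q p k ∘ nabla_map S (q ∘ p) Hu)
            = pr1 S p (pr1 S q k)
                ∘ (nabla_map S p Hu' ∘ nabla_comp_map S q p h))
    by now rewrite !comp_assoc, B1, C1, D1, A1.
  apply chosen_ext; [exact G|].
  apply chosen_ext.
  - rewrite !(comp_assoc (pr1 S q k)), <- !(chosen_commutes S p).
    now rewrite <- !(comp_assoc p), G.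
  - rewrite !comp_assoc, B2, C2, <- A2.
    rewrite <- (comp_assoc (pr2 S q k) (pr2 S p _)), D2.
    now rewrite !comp_assoc, F2.
Qed.

Lemma nabla_comp_map_iso {E : Category} (S : LocallySubcartesian E)
  {W Y Z H : E} (q : hom Y Z) (p : hom W Y) (h : hom H Z) :
  is_iso (nabla_comp_map S q p h).
Proof.
  destruct (span_iso_map (chosen_binary S p q h)) as [k [H1 H2]].
  destruct (nabla_comp_map_spec S q p h) as [A1 A2].
  exists k; split.
  - apply chosen_ext; rewrite comp_id_r, comp_assoc; congruence.
  - assert (G : pr1 S p (pr1 S q h) ∘ (nabla_comp_map S q p h ∘ k)
              = pr1 S p (pr1 S q h))
      by now rewrite comp_assoc, A1, H1.
    apply chosen_ext; rewrite comp_id_r; [exact G|].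
    apply chosen_ext.
    + rewrite (comp_assoc (pr1 S q h)), <- !(chosen_commutes S p).
      now rewrite <- (comp_assoc p), G.
    + now rewrite !comp_assoc, A2, H2.
Qed.

(* The component at [h] is the unique isomorphism compatible with the
   projections to [W] and to the domain of [h]. *)
Definition nabla_comp {E : Category} (S : LocallySubcartesian E)
  {W Y Z : E} (q : hom Y Z) (p : hom W Y) :
  NatIso (Nabla S (q ∘ p)) (Nabla S p ○ Nabla S q).
Proof.
  unshelve refine {| iso_nat := @Build_NatTrans _ _
    (Nabla S (q ∘ p)) (Nabla S p ○ Nabla S q)
    (fun h => @Build_SliceHom E W (Nabla S (q ∘ p) h) ((Nabla S p ○ Nabla S q) h)
       (nabla_comp_map S q p (arr h)) _) _ |}.
  - apply nabla_comp_map_spec.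
  - intros h k u; apply slice_ext, nabla_comp_map_natural.
  - apply invertible_of_components; intros h; apply slice_iso.
    apply nabla_comp_map_iso.
Defined.

Lemma factoring_hid {E : Category} (S : LocallySubcartesian E) {A X : E}
  (p : hom A X) : factoring_square S (idm A) p p (idm X).
Proof.
  split.
  - unfold commutes; now rewrite comp_id_l, comp_id_r.
  - destruct (is_identity_iso (chosen_nullary S p (is_identity_idm X)))
      as [v [Hv1 Hv2]].
    exists v; split; [exact Hv2|].
    rewrite <- (comp_id_l (pr2 S p (idm X))), <- chosen_commutes.
    now rewrite <- comp_assoc, Hv2, comp_id_r.
Qed.

Lemma factoring_vid {E : Category} (S : LocallySubcartesian E) {B X : E}
  (f : hom B X) : factoring_square S f (idm B) (idm X) f.
Proof.
  split.
  - unfold commutes; now rewrite comp_id_l, comp_id_r.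
  - apply span_map_swap.
    exact (span_map_trans (square_factors (factoring_hid S f))
                          (span_iso_map (chosen_symmetry S f (idm X)))).
Qed.

Lemma factoring_hpaste {E : Category} (S : LocallySubcartesian E)
  {P A C B X Z : E} {f' : hom P A} {g' : hom A C} {f : hom B X} {g : hom X Z}
  {p' : hom P B} {p : hom A X} {q : hom C Z} :
  factoring_square S f' p' p f -> factoring_square S g' p q g ->
  factoring_square S (g' ∘ f') p' q (g ∘ f).
Proof.
  intros [C1 F1] [C2 F2]; unfold commutes in *; split.
  - unfold commutes; now rewrite comp_assoc, C2, <- comp_assoc, C1, comp_assoc.
  - destruct (span_map_trans F2 (span_iso_map (chosen_symmetry S q g)))
      as [l [L1 L2]].
    destruct (nabla_map_exists S f L2) as [m [[M1 M2] _]].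
    destruct (span_map_trans F1 (span_iso_map (chosen_symmetry S p f)))
      as [k [K1 K2]].
    apply span_map_swap.
    refine (span_map_trans _ (span_iso_map (chosen_symmetry S (g ∘ f) q))).
    refine (span_map_trans _ (span_iso_map (chosen_binary S f g q))).
    exists (m ∘ k); split.
    + now rewrite comp_assoc, M1, K2.
    + rewrite comp_assoc, <- (comp_assoc _ _ m), M2.
      now rewrite !comp_assoc, L1, <- comp_assoc, K1.
Qed.

Lemma factoring_vpaste {E : Category} (S : LocallySubcartesian E)
  {Q C P A B X : E} {f'' : hom Q C} {f' : hom P A} {f : hom B X}
  {q' : hom Q P} {q : hom C A} {p' : hom P B} {p : hom A X} :
  factoring_square S f' p' p f -> factoring_square S f'' q' q f' ->
  factoring_square S f'' (p' ∘ q') (p ∘ q) f.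
Proof.
  intros [C1 F1] [C2 F2]; unfold commutes in *; split.
  - unfold commutes; now rewrite <- comp_assoc, C2, comp_assoc, C1, comp_assoc.
  - refine (span_map_trans _ (span_iso_map (chosen_binary S q p f))).
    destruct F1 as [l [L1 L2]], F2 as [k [K1 K2]].
    destruct (nabla_map_exists S q L1) as [m [[M1 M2] _]].
    exists (m ∘ k); split.
    + now rewrite comp_assoc, M1.
    + now rewrite comp_assoc, <- (comp_assoc _ _ m), M2, !comp_assoc, L2,
        <- comp_assoc, K2.
Qed.

Definition exchange_family {E : Category} (S : LocallySubcartesian E) : Type :=
  forall (P A B X : E) (f' : hom P A) (p' : hom P B) (p : hom A X) (f : hom B X),
    factoring_square S f' p' p f ->
    NatTrans (Sigma f' ○ Nabla S p') (Nabla S p ○ Sigma f).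

Definition canonical_family {E : Category} (S : LocallySubcartesian E)
  (b : exchange_family S) : Prop :=
  forall (P A B X : E) (f' : hom P A) (p' : hom P B) (p : hom A X) (f : hom B X)
    (s : factoring_square S f' p' p f) (h : Slice B),
    unique (fun m : hom (tens S p' (arr h)) (tens S p (f ∘ arr h)) =>
              pr1 S p (f ∘ arr h) ∘ m = f' ∘ pr1 S p' (arr h) /\
              pr2 S p (f ∘ arr h) ∘ m = pr2 S p' (arr h))
           (mor (b P A B X f' p' p f s h)).

(* Square with both horizontal sides identities. *)
Definition nullary_coherent_h {E : Category} (S : LocallySubcartesian E)
  (b : exchange_family S) : Prop :=
  forall (A X : E) (p : hom A X),
    whisker_l (Nabla S p) (sigma_id X) • b _ _ _ _ _ _ _ _ (factoring_hid S p)
    = hid (Nabla S p) • whisker_r (sigma_id A) (Nabla S p).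

(* Square with both vertical sides identities. *)
Definition nullary_coherent_v {E : Category} (S : LocallySubcartesian E)
  (b : exchange_family S) : Prop :=
  forall (B X : E) (f : hom B X),
    whisker_r (nabla_id S X) (Sigma f) • b _ _ _ _ _ _ _ _ (factoring_vid S f)
    = vid (Sigma f) • whisker_l (Sigma f) (nabla_id S B).

(* The square [t] is pasted to the right of [s] along [p]. *)
Definition binary_coherent_h {E : Category} (S : LocallySubcartesian E)
  (b : exchange_family S) : Prop :=
  forall (P A C B X Z : E) (f' : hom P A) (g' : hom A C) (f : hom B X)
    (g : hom X Z) (p' : hom P B) (p : hom A X) (q : hom C Z)
    (s : factoring_square S f' p' p f) (t : factoring_square S g' p q g),
    whisker_l (Nabla S q) (sigma_comp g f)
      • b _ _ _ _ _ _ _ _ (factoring_hpaste s t)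
    = hpaste (b _ _ _ _ _ _ _ _ s) (b _ _ _ _ _ _ _ _ t)
      • whisker_r (sigma_comp g' f') (Nabla S p').

(* The square [t] is pasted on top of [s] along [f']. *)
Definition binary_coherent_v {E : Category} (S : LocallySubcartesian E)
  (b : exchange_family S) : Prop :=
  forall (Q C P A B X : E) (f'' : hom Q C) (f' : hom P A) (f : hom B X)
    (q' : hom Q P) (q : hom C A) (p' : hom P B) (p : hom A X)
    (s : factoring_square S f' p' p f) (t : factoring_square S f'' q' q f'),
    whisker_r (nabla_comp S p q) (Sigma f)
      • b _ _ _ _ _ _ _ _ (factoring_vpaste s t)
    = vpaste (b _ _ _ _ _ _ _ _ s) (b _ _ _ _ _ _ _ _ t)
      • whisker_l (Sigma f'') (nabla_comp S p' q').

(* Main.v *)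
(** Stacking the chosen square of [p'] and [h : M -> B] on a factoring square
    [s] gives a square on [p] and [f ∘ h] that factors again, and [b] at [h] is
    its comparison morphism.  Chosen squares are jointly monic, so naturality
    and coherence hold because both sides have the same projections.  If [s] is
    a subpullback, then so is the stacked square; conversely, at [h = idm B] the
    comparison morphism is that of [s] itself, up to isomorphism. *)

From Stdlib Require Import ClassicalEpsilon.
Require Import Defs.

Set Implicit Arguments.
Unset Strict Implicit.
Unset Printing Implicit Defensive.

(** * Isomorphisms of spans and joint monicity *)

Lemma is_iso_comp {C : Category} {A B D : C} (g : hom B D) (f : hom A B) :
  is_iso g -> is_iso f -> is_iso (g ∘ f).
Proof.
  intros [g' [G1 G2]] [f' [F1 F2]]; exists (f' ∘ g'); split.
  - now rewrite <- comp_assoc, (comp_assoc g'), G1, comp_id_l.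
  - now rewrite <- comp_assoc, (comp_assoc f), F2, comp_id_l.
Qed.

Lemma slice_iso_mor {E : Category} {X : E} {h k : Slice X} (u : hom h k) :
  is_iso u -> is_iso (mor u).
Proof.
  intros [v [H1 H2]]; exists (mor v); split.
  - exact (f_equal (@mor _ _ _ _) H1).
  - exact (f_equal (@mor _ _ _ _) H2).
Qed.

Lemma invertible_component {C D : Category} {F G : Functor C D}
  (a : NatTrans F G) (A : C) : invertible a -> is_iso (a A).
Proof.
  intros [b [H1 H2]]; exists (b A); split.
  - exact (f_equal (fun n => component n A) H1).
  - exact (f_equal (fun n => component n A) H2).
Qed.

Lemma span_iso_trans {E : Category} {P P' P'' A B : E}
  {a : hom P A} {b : hom P B} {a' : hom P' A} {b' : hom P' B}
  {a'' : hom P'' A} {b'' : hom P'' B} :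
  span_iso a b a' b' -> span_iso a' b' a'' b'' -> span_iso a b a'' b''.
Proof.
  intros [k [Hk [<- <-]]] [l [Hl [<- <-]]]; exists (l ∘ k).
  split; [now apply is_iso_comp|]; now rewrite !comp_assoc.
Qed.

Lemma span_iso_sym {E : Category} {P P' A B : E}
  {a : hom P A} {b : hom P B} {a' : hom P' A} {b' : hom P' B} :
  span_iso a b a' b' -> span_iso a' b' a b.
Proof.
  intros [k [[l [H1 H2]] [<- <-]]]; exists l; split; [now exists k|].
  now rewrite <- !comp_assoc, H2, !comp_id_r.
Qed.

Lemma jointly_monic_span_iso {E : Category} {P P' A B : E}
  {a : hom P A} {b : hom P B} {a' : hom P' A} {b' : hom P' B} :
  span_iso a b a' b' -> jointly_monic a' b' -> jointly_monic a b.
Proof.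
  intros [k [[l [H1 _]] [<- <-]]] J Z u v Hu Hv.
  rewrite <- !comp_assoc in Hu, Hv.
  rewrite <- (comp_id_l u), <- (comp_id_l v), <- H1, <- !comp_assoc.
  f_equal; now apply J.
Qed.

(** A comparison back, [l], is automatically inverse to [k]: both composites preserve the legs of a
    jointly monic span, as identities do. *)
Lemma jointly_monic_map_iso {E : Category} {P P' A B : E}
  {a : hom P A} {b : hom P B} {a' : hom P' A} {b' : hom P' B} {k : hom P P'} :
  jointly_monic a b -> jointly_monic a' b' -> a' ∘ k = a -> b' ∘ k = b ->
  span_map a' b' a b -> is_iso k.
Proof.
  intros J J' H1 H2 [l [L1 L2]]; exists l; split.
  - apply J; rewrite comp_assoc, comp_id_r; congruence.
  - apply J'; rewrite comp_assoc, comp_id_r; congruence.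
Qed.

(** * The transformation attached to one factoring square *)

Section Exchange.
Context {E : Category} (S : LocallySubcartesian E).

Lemma factoring_chosen {A B X : E} (f : hom A X) (g : hom B X) :
  factoring_square S (pr1 S f g) (pr2 S f g) f g.
Proof.
  split; [apply chosen_commutes|].
  exists (idm _); now rewrite !comp_id_r.
Qed.

Section Square.
Context {P A B X : E} {f' : hom P A} {p' : hom P B} {p : hom A X} {f : hom B X}.

Lemma exchange_exists (s : factoring_square S f' p' p f) {M : E} (h : hom M B) :
  exists m : hom (tens S p' h) (tens S p (f ∘ h)),
    pr1 S p (f ∘ h) ∘ m = f' ∘ pr1 S p' h /\ pr2 S p (f ∘ h) ∘ m = pr2 S p' h.
Proof. exact (square_factors (factoring_hpaste (factoring_chosen p' h) s)). Qed.

(** Choice extracts the morphism from its mere existence; by [chosen_ext] there is only one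
    candidate. *)
Definition exchange_map (s : factoring_square S f' p' p f) {M : E}
  (h : hom M B) : hom (tens S p' h) (tens S p (f ∘ h)) :=
  proj1_sig (constructive_indefinite_description _ (exchange_exists s h)).

Lemma exchange_map_spec (s : factoring_square S f' p' p f) {M : E}
  (h : hom M B) :
  pr1 S p (f ∘ h) ∘ exchange_map s h = f' ∘ pr1 S p' h /\
  pr2 S p (f ∘ h) ∘ exchange_map s h = pr2 S p' h.
Proof.
  exact (proj2_sig (constructive_indefinite_description _ (exchange_exists s h))).
Qed.

(** [Hu'] is left as a variable so that the equation matches the proof that [sigma_hom] carries. *)
Lemma exchange_map_natural (s : factoring_square S f' p' p f) {M N : E}
  {h : hom M B} {k : hom N B} (u : hom M N) (Hu : k ∘ u = h)
  (Hu' : f ∘ k ∘ u = f ∘ h) :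
  exchange_map s k ∘ nabla_map S p' Hu = nabla_map S p Hu' ∘ exchange_map s h.
Proof.
  destruct (exchange_map_spec s h) as [A1 A2], (exchange_map_spec s k) as [B1 B2].
  destruct (nabla_map_spec S p' Hu) as [C1 C2], (nabla_map_spec S p Hu') as [D1 D2].
  apply chosen_ext; rewrite !comp_assoc.
  - now rewrite B1, D1, A1, <- comp_assoc, C1.
  - now rewrite B2, D2, C2, <- comp_assoc, A2.
Qed.

Definition exchange (s : factoring_square S f' p' p f) :
  NatTrans (Sigma f' ○ Nabla S p') (Nabla S p ○ Sigma f).
Proof.
  unshelve refine (@Build_NatTrans _ _
    (Sigma f' ○ Nabla S p') (Nabla S p ○ Sigma f)
    (fun h => @Build_SliceHom E A ((Sigma f' ○ Nabla S p') h)
       ((Nabla S p ○ Sigma f) h) (exchange_map s (arr h)) _) _).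
  - apply exchange_map_spec.
  - intros h k u; apply slice_ext, exchange_map_natural.
Defined.

(** The binary axiom splits off a factor of the first leg of a cospan, so [p] and [f ∘ h] are
    swapped first. It then leads to the chosen square of [h] and [pr1 S f p]. The subpullback
    hypothesis gives a map [l] over [B] to [p'], and the action of nabla along [h] on [l], followed
    by a swap, ends at the chosen square of [p'] and [h]. *)
Lemma subpullback_hpaste_map {M : E} (h : hom M B) :
  is_subpullback S f' p' p f ->
  span_map (pr1 S p (f ∘ h)) (pr2 S p (f ∘ h)) (f' ∘ pr1 S p' h) (pr2 S p' h).
Proof.
  intros [_ I].
  destruct (span_map_trans
    (span_iso_map (chosen_symmetry S f p))
    (span_map_swap (span_iso_map_inv I))) as [l [L1 L2]].
  destruct (span_map_trans
    (span_iso_map (chosen_symmetry S p (f ∘ h)))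
    (span_map_swap (span_iso_map_inv (chosen_binary S h f p)))) as [k [K1 K2]].
  destruct (nabla_map_spec S h L1) as [N1 N2].
  destruct (span_iso_map (chosen_symmetry S h p')) as [t [T1 T2]].
  exists (t ∘ nabla_map S h L1 ∘ k); split; rewrite !comp_assoc.
  - rewrite <- (comp_assoc f'), T2, <- (comp_assoc f'), N2.
    now rewrite comp_assoc, L2, K1.
  - now rewrite T1, N1.
Qed.

Lemma exchange_map_iso (s : factoring_square S f' p' p f) {M : E}
  (h : hom M B) :
  is_subpullback S f' p' p f -> is_iso (exchange_map s h).
Proof.
  intros I; destruct (exchange_map_spec s h) as [H1 H2].
  refine (jointly_monic_map_iso _ (proj2 (chosen_subcartesian S _ _))
            H1 H2 (subpullback_hpaste_map h I)).
  (* The stacked span is jointly monic: [u] and [v] agree on the second projection by [Hv], hence on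
     [p' ∘ pr1 S p' h] by commutativity; with [Hu], joint monicity of [f'] and [p'] settles the
     first projection. *)
  intros Z u v Hu Hv; apply chosen_ext; [|exact Hv].
  apply (jointly_monic_span_iso (proj2 I)
           (proj2 (chosen_subcartesian S _ _))).
  - now rewrite !comp_assoc.
  - now rewrite !comp_assoc, chosen_commutes, <- !comp_assoc, Hv.
Qed.

Lemma subpullback_of_exchange_iso (s : factoring_square S f' p' p f) :
  is_iso (exchange_map s (idm B)) -> is_subpullback S f' p' p f.
Proof.
  intros I; split; [exact (square_commutes s)|].
  destruct (exchange_map_spec s (idm B)) as [H1 H2].
  assert (J : span_iso (f' ∘ pr1 S p' (idm B)) (pr2 S p' (idm B))
                       (pr1 S p f) (pr2 S p f)).
  (* The codomain of the map mentions [f ∘ idm B], so the map is generalized before this is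
     rewritten to [f]. *)
  { revert I H1 H2; generalize (exchange_map s (idm B)).
    rewrite (comp_id_r f); intros k I H1 H2; now exists k. }
  (* By the nullary axiom [pr1 S p' (idm B)] is an identity, which identifies the stacked span with
     that of [s]. *)
  refine (span_iso_trans (span_iso_sym _) J).
  exists (pr1 S p' (idm B)); split; [|split; [reflexivity|]].
  - apply is_identity_iso, chosen_nullary, is_identity_idm.
  - now rewrite chosen_commutes, comp_id_l.
Qed.

Lemma exchange_invertible (s : factoring_square S f' p' p f) :
  invertible (exchange s) <-> is_subpullback S f' p' p f.
Proof.
  split; intros H.
  - apply (subpullback_of_exchange_iso (s := s)).
    exact (slice_iso_mor (invertible_component
      ({| dom := B; arr := idm B |} : Slice B) H)).
  - apply invertible_of_components; intros h.
    now apply slice_iso, exchange_map_iso.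
Qed.

End Square.

(** * Canonicity and coherence of the whole family *)

Definition exchanges : exchange_family S :=
  fun P A B X f' p' p f s => exchange s.

Lemma exchanges_canonical : canonical_family exchanges.
Proof.
  intros P A B X f' p' p f s h; simpl.
  destruct (exchange_map_spec s (arr h)) as [H1 H2].
  split; [now split|].
  intros m [M1 M2]; apply chosen_ext; congruence.
Qed.

Lemma exchanges_nullary_h : nullary_coherent_h exchanges.
Proof.
  intros A X p; apply nat_ext; intros h; apply slice_ext; simpl.
  destruct (exchange_map_spec (factoring_hid S p) (arr h)) as [H1 H2].
  (* The map induced by [sigma_id] matters only through its projections [N1] and [N2], so its body
     is forgotten. *)
  match goal with |- nabla_map S p ?H ∘ _ = _ =>
    destruct (nabla_map_spec S p H) as [N1 N2];
    set (n := nabla_map S p H) in *; clearbody n end.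
  rewrite (comp_id_l (idm (tens S p (arr h)))).
  apply chosen_ext; rewrite comp_id_r, comp_assoc.
  - rewrite N1, H1; apply comp_id_l.
  - now rewrite N2, (comp_id_l (pr2 S p _)), H2.
Qed.

Lemma exchanges_nullary_v : nullary_coherent_v exchanges.
Proof.
  intros B X f; apply nat_ext; intros h; apply slice_ext; simpl.
  (* [nabla_id] is a second projection, so this is the second defining equation of
     [exchange_map]. *)
  rewrite comp_id_l; apply exchange_map_spec.
Qed.

Lemma exchanges_binary_h : binary_coherent_h exchanges.
Proof.
  intros P A C B X Z f' g' f g p' p q s t.
  apply nat_ext; intros h; apply slice_ext; simpl.
  destruct (exchange_map_spec s (arr h)) as [S1 S2].
  destruct (exchange_map_spec t (f ∘ arr h)) as [T1 T2].
  destruct (exchange_map_spec (factoring_hpaste s t) (arr h)) as [U1 U2].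
  match goal with |- nabla_map S q ?H ∘ _ = _ =>
    destruct (nabla_map_spec S q H) as [N1 N2];
    set (n := nabla_map S q H) in *; clearbody n end.
  rewrite (comp_id_r (_ ∘ _)).
  apply chosen_ext; rewrite (comp_assoc _ n), comp_assoc.
  - now rewrite N1, U1, T1, <- (comp_assoc g' (pr1 S p _)), S1,
      comp_assoc.
  - now rewrite N2, (comp_id_l (pr2 S q _)), U2, T2, S2.
Qed.

Lemma exchanges_binary_v : binary_coherent_v exchanges.
Proof.
  intros Q C P A B X f'' f' f q' q p' p s t.
  apply nat_ext; intros h; apply slice_ext; simpl.
  destruct (exchange_map_spec s (arr h)) as [S1 S2].
  destruct (exchange_map_spec t (pr1 S p' (arr h))) as [T1 T2].
  destruct (exchange_map_spec (factoring_vpaste s t) (arr h)) as [U1 U2].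
  destruct (nabla_comp_map_spec S p q (f ∘ arr h)) as [V1 V2].
  destruct (nabla_comp_map_spec S p' q' (arr h)) as [W1 W2].
  match goal with |- _ = nabla_map S q ?H ∘ _ ∘ _ =>
    destruct (nabla_map_spec S q H) as [N1 N2] end.
  match goal with |- ?l = ?r => set (x := l); set (y := r) end.
  assert (G : pr1 S q (pr1 S p (f ∘ arr h)) ∘ x
              = pr1 S q (pr1 S p (f ∘ arr h)) ∘ y).
  { unfold x, y; rewrite !comp_assoc.
    now rewrite V1, U1, N1, T1, <- !comp_assoc, W1. }
  (* The target is an iterated apex, so joint monicity is used twice. [G] compares the projections
     to [C], and through commutativity of the outer chosen square also those to [A]; only the
     projection to the domain of [h] is computed afresh. *)
  apply chosen_ext; [exact G|]; apply chosen_ext; rewrite !comp_assoc.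
  - now rewrite <- !chosen_commutes, <- !comp_assoc, G.
  - unfold x, y; rewrite !comp_assoc, V2, U2.
    rewrite <- (comp_assoc (pr2 S p _)), N2.
    now rewrite !comp_assoc, S2, <- (comp_assoc (pr2 S p' _)), T2.
Qed.

End Exchange.

Theorem proposition3p1p7 (E : Category) (S : LocallySubcartesian E) :
  exists b : exchange_family S,
    canonical_family b /\
    nullary_coherent_h b /\ nullary_coherent_v b /\
    binary_coherent_h b /\ binary_coherent_v b /\
    forall (P A B X : E)
      (f' : hom P A) (p' : hom P B) (p : hom A X) (f : hom B X)
      (s : factoring_square S f' p' p f),
      invertible (b P A B X f' p' p f s) <-> is_subpullback S f' p' p f.
Proof.
  exists (@exchanges E S).
  split; [apply exchanges_canonical|].
  split; [apply exchanges_nullary_h|].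
  split; [apply exchanges_nullary_v|].
  split; [apply exchanges_binary_h|].
  split; [apply exchanges_binary_v|].
  intros; apply exchange_invertible.
Qed.
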